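(* For every integer $n\ge 3$ and every $k\ge 4$ (where $k$ is a positive integer or an infinite cardinal) there exists an irreducible $n$-quasigroup of order $k$, i.e., a set $\Sigma$ with $|\Sigma|=k$ and an $n$-quasigroup $f:\Sigma^n\to\Sigma$ that is not reducible.
   Context: For a nonempty set $\Sigma$ and a positive integer $n$, an $n$-ary operation $f:\Sigma^n\to\Sigma$ is an $n$-quasigroup (of order $|\Sigma|$) if in the equality $z_0=f(z_1,\ldots,z_n)$ knowledge of any $n$ of the elements $z_0,\ldots,z_n$ uniquely specifies the remaining one. An $n$-quasigroup $f$ is reducible if there exist an integer $k'$ with $1<k'<n$, a permutation $\sigma$ of $\{1,\ldots,n\}$, an $(n-k'+1)$-quasigroup $h$ and a $k'$-quasigroup $g$ on $\Sigma$ such that $f(x_1,\ldots,x_n)=h\big(g(x_{\sigma(1)},\ldots,x_{\sigma(k')}),x_{\sigma(k'+1)},\ldots,x_{\sigma(n)}\big)$ identically; otherwise $f$ is irreducible. *)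

(* Defs.v *)
From mathcomp Require Import all_boot perm.

Set Implicit Arguments.
Unset Strict Implicit.
Unset Printing Implicit Defensive.

(* [{ffun 'I_n -> S}] plays the role of S^n; the coordinates x_1, ..., x_n
   are numbered from 0 to n - 1. *)
Definition operation (n : nat) (S : Type) : Type := {ffun 'I_n -> S} -> S.

(* [z : 'I_n.+1 -> S] lists z_0, z_1, ..., z_n, so [lift ord0 j] is the index
   of the j-th argument of [f]. *)
Definition satisfies (n : nat) (S : Type) (f : operation n S)
    (z : 'I_n.+1 -> S) : Prop :=
  z ord0 = f [ffun j => z (lift ord0 j)].

(* The value [z i] is irrelevant: [dfwith z (i := i) a] overwrites it with [a]. *)
Definition quasigroup (n : nat) (S : Type) (f : operation n S) : Prop :=
  forall (i : 'I_n.+1) (z : 'I_n.+1 -> S),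
    exists! a : S, satisfies f (dfwith z (i := i) a).

Definition tuple_cons (m : nat) (S : Type) (a : S) (t : {ffun 'I_m -> S}) :
    {ffun 'I_m.+1 -> S} :=
  [ffun i => if unlift ord0 i is Some j then t j else a].

(* Through [k + (n - k) = n], [lshift] and [rshift] enumerate the first [k] and
   the last [n - k] indices; [h] has arity n - k + 1. *)
Definition reducible (n : nat) (S : Type) (f : operation n S) : Prop :=
  exists (k : nat) (_ : 1 < k) (lt_kn : k < n) (s : 'S_n)
         (h : operation (n - k).+1 S) (g : operation k S),
    let idx := cast_ord (subnKC (ltnW lt_kn)) in
    [/\ quasigroup h, quasigroup g
      & forall x : {ffun 'I_n -> S},
          f x = h (tuple_cons
                     (g [ffun i : 'I_k => x (s (idx (lshift (n - k) i)))])
                     [ffun j : 'I_(n - k) => x (s (idx (rshift k j)))])].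

Definition irreducible (n : nat) (S : Type) (f : operation n S) : Prop :=
  ~ reducible f.

(* Main.v *)
Require Import Defs.
From Stdlib Require Import PeanoNat.
From HB Require Import structures.
From mathcomp Require Import all_boot perm all_algebra.
From mathcomp Require Import boolp classical_sets functions cardinality.

Set Implicit Arguments.
Unset Strict Implicit.
Unset Printing Implicit Defensive.

(* Let [op] be a loop with neutral element [e], a subloop [{e, u}] of order 2
   and elements [a, b] outside it such that [ab = ba = e]. In the n-quasigroup
   [x_1 (x_2 (... x_n))] exchange the values [e] and [u] on the subcube
   [{e, u}^n]; the result [f] is again an n-quasigroup. If [f] were reducible,
   with the inner quasigroup taking the arguments i and j but not l, then two
   settings of i and j giving the same value of [f] for one choice of the other
   arguments would do so for all choices. But when all other arguments are [e],
   the settings [(e, e)] and [(a, b)] of (i, j) give [u] and [e], whereas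
   changing argument l to [a] yields [a] in both cases.

   Such loops exist in every order k >= 4: the group Z_2 x Z_m for k = 2m, a
   two-fold prolongation of an isotope of Z_(k-2) for k odd, and, for k
   infinite, a Steiner loop obtained by Zorn's lemma. *)

(** * Cancellation in quasigroups, and the loops to be switched *)

(** If [p] and [q] give the same value, both solve for z_1 the equation in which z_0 is this value
    and the remaining arguments are [t]. *)
Lemma quasigroup_consI (m : nat) (S : Type) (h : operation m.+1 S) t :
  quasigroup h -> injective (fun p => h (tuple_cons p t)).
Proof.
move=> qh p q hpq.
pose z (k : 'I_m.+2) : S :=
  if unlift ord0 k is Some j then tuple_cons p t j else h (tuple_cons p t).
have E r : h (tuple_cons r t) = h (tuple_cons p t) ->
    satisfies h (dfwith z (i := lift ord0 ord0) r).
  move=> hr; rewrite /satisfies dfwith_out 1?eq_sym ?neq_lift //.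
  rewrite {1}/z unlift_none -hr; congr h; apply/ffunP => j; rewrite !ffunE.
  case: (unliftP ord0 j) => [j'|] ->; last by rewrite dfwith_in.
  rewrite dfwith_out ?(inj_eq lift_inj) ?neq_lift // /z !liftK ffunE.
  by rewrite liftK.
have [r [_ r_uniq]] := qh (lift ord0 ord0) z.
by rewrite -(r_uniq p (E p erefl)) -(r_uniq q (E q (esym hpq))).
Qed.

Record switchable_loop (S : eqType) (op : S -> S -> S) (e u a b : S) : Prop :=
  SwitchableLoop {
    op_bijl : forall x, bijective (op x);
    op_bijr : forall y, bijective (op^~ y);
    op1x : left_id e op;
    opx1 : right_id e op;
    u_neq1 : u != e;
    opuu : op u u = e;
    a_neq1 : a != e;
    a_nequ : a != u;
    opab : op a b = e;
    opba : op b a = e }.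

(** * The switched product: quasigroup property and irreducibility *)

Section Switching.

Variables (n : nat) (S : eqType) (op : S -> S -> S) (e u a b : S).
Hypothesis L : switchable_loop op e u a b.

Implicit Types (x : {ffun 'I_n -> S}) (s : seq 'I_n) (i j l : 'I_n).

Let small : pred S := pred2 e u.

Let swap (y : S) : S := if y == e then u else if y == u then e else y.

Definition loop_prod s x : S := foldr op e [seq x i | i <- s].

Definition switched_prod : operation n S := fun x =>
  let y := loop_prod (enum 'I_n) x in
  if [forall i, small (x i)] then swap y else y.

Let upd j x (c : S) : {ffun 'I_n -> S} :=
  [ffun i => if i == j then c else x i].

Let swapK : involutive swap.
Proof.
move=> y; rewrite /swap; case: (eqVneq y e) => [->|ye].
  by rewrite eqxx (negPf (u_neq1 L)).
by case: (eqVneq y u) => [->|yu]; rewrite ?eqxx // (negPf ye) (negPf yu).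
Qed.

Lemma eq_loop_prod s x x' : {in s, x =1 x'} -> loop_prod s x = loop_prod s x'.
Proof. by move=> xx'; congr foldr; apply/eq_in_map. Qed.

(** In a right-nested product a neutral factor occurs only as ey = y, so it drops out without
    associativity. *)
Lemma loop_prod_filter (p : pred 'I_n) s x :
  (forall i, ~~ p i -> x i = e) -> loop_prod s x = loop_prod (filter p s) x.
Proof.
move=> xE; elim: s => //= i s IH; rewrite {1}/loop_prod /= -/(loop_prod s x) IH.
by case: ifPn => [//|/xE ->]; rewrite (op1x L).
Qed.

Lemma loop_prod3 i j l x : i < j -> j < l ->
  (forall k, k \notin [:: i; j; l] -> x k = e) ->
  loop_prod (enum 'I_n) x = op (x i) (op (x j) (x l)).
Proof.
move=> ij jl xE; rewrite (loop_prod_filter _ xE).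
suff -> : [seq k <- enum 'I_n | k \in [:: i; j; l]] = [:: i; j; l].
  by rewrite /loop_prod /= (opx1 L).
have tr : transitive (relpre (@nat_of_ord n) ltn).
  by move=> ? ? ?; apply: ltn_trans.
(* Two strictly increasing lists with the same members coincide. *)
apply: (@irr_sorted_eq _ (relpre (@nat_of_ord n) ltn)) => //.
- by move=> k /=; rewrite ltnn.
- apply: sorted_filter => //; rewrite -sorted_map val_enum_ord.
  exact: iota_ltn_sorted.
- by rewrite /= ij jl.
by move=> k; rewrite mem_filter mem_enum andbT.
Qed.

Let loop_prod_upd j s x c : j \notin s ->
  loop_prod s (upd j x c) = loop_prod s x.
Proof.
move=> js; apply: eq_loop_prod => i i_s; rewrite ffunE.
by case: eqP js => // <-; rewrite i_s.
Qed.

(** The factors before [j] act by left translations; at [j] the product of the later factors, which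
    does not involve [c], acts by a right translation. *)
Let loop_prod_bij j s x : uniq s -> j \in s ->
  bijective (fun c => loop_prod s (upd j x c)).
Proof.
elim: s => //= i s IH /andP[i_s us]; rewrite inE => js.
case: (eqVneq j i) js => [-> _|ji /= js].
  apply: (eq_bij (op_bijr L (loop_prod s x))) => c.
  by rewrite -(loop_prod_upd x c i_s) /loop_prod /= ffunE eqxx.
apply: (eq_bij (bij_comp (op_bijl L (x i)) (IH us js))) => c.
by rewrite /loop_prod /= ffunE eq_sym (negPf ji).
Qed.

(** Since {e, u} = {uu, ue}, cancelling u shows that this set contains uz exactly when it contains
    z. *)
Let small_op y z : small y -> small (op y z) = small z.
Proof.
case/pred2P => ->; first by rewrite (op1x L).
have ->: small (op u z) = (op u z == op u u) || (op u z == op u e).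
  by rewrite (opuu L) (opx1 L).
by rewrite !(inj_eq (bij_inj (op_bijl L u))) orbC.
Qed.

Let small_op' y z : small z -> small (op y z) = small y.
Proof.
case/pred2P => ->; first by rewrite (opx1 L).
have ->: small (op y u) = (op y u == op u u) || (op y u == op e u).
  by rewrite (opuu L) (op1x L).
by rewrite !(inj_eq (bij_inj (op_bijr L u))) orbC.
Qed.

Let small_prod s x : {in s, forall i, small (x i)} -> small (loop_prod s x).
Proof.
elim: s => [_|i s IH sx]; first by rewrite /small /= eqxx.
rewrite /loop_prod /= -/(loop_prod s x) small_op ?sx ?mem_head //.
by apply: IH => k ks; rewrite sx // inE ks orbT.
Qed.

Let small_prod_upd j s x c : uniq s -> j \in s ->
  (forall i, i != j -> small (x i)) ->
  small (loop_prod s (upd j x c)) = small c.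
Proof.
move=> + + sx; elim: s => //= i s IH /andP[i_s us]; rewrite inE => js.
rewrite /loop_prod /= -/(loop_prod s (upd j x c)).
case: (eqVneq j i) js => [ji _|ji /= js].
  subst i; rewrite small_op' ?ffunE ?eqxx // loop_prod_upd //.
  rewrite small_prod // => k ks.
  by apply: sx; apply: contraNneq i_s => <-.
by rewrite small_op ?IH // ffunE eq_sym (negPf ji) sx // eq_sym.
Qed.

(** If all other arguments lie in {e, u}, the product lies there exactly when [c] does, so the map
    is the unswitched one followed by [swap], which fixes everything outside {e, u}. Otherwise no
    exchange takes place for any [c]. *)
Let switched_bij j x : bijective (fun c => switched_prod (upd j x c)).
Proof.
have B := loop_prod_bij x (enum_uniq 'I_n) (mem_enum 'I_n j).
case: (boolP [forall (i | i != j), small (x i)]) => [/forall_inP sx|].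
  apply: (eq_bij (bij_comp (inv_bij swapK) B)) => c /=.
  have sc := small_prod_upd c (enum_uniq 'I_n) (mem_enum 'I_n j) sx.
  rewrite /switched_prod; case: ifPn => // /forallPn[i].
  rewrite ffunE; case: eqP => [_ |/eqP ij]; last by rewrite sx.
  rewrite -sc /swap; set y := loop_prod _ _.
  by rewrite /small /= negb_or => /andP[/negPf -> /negPf ->].
case/forall_inPn => i ij sxi; apply: (eq_bij B) => c.
rewrite /switched_prod ifF //; apply/negbTE/forallPn; exists i.
by rewrite ffunE (negPf ij).
Qed.

Lemma switched_quasigroup : quasigroup switched_prod.
Proof.
move=> k z; case: (unliftP ord0 k) => [j|] ->; last first.
  exists (switched_prod [ffun j => z (lift ord0 j)]).
  have E c : [ffun j : 'I_n => dfwith z (i := ord0) c (lift ord0 j)]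
             = [ffun j => z (lift ord0 j)].
    by apply/ffunP => j; rewrite !ffunE dfwith_out // eq_sym neq_lift.
  by split=> [|c]; rewrite /satisfies dfwith_in E.
pose x := [ffun i => z (lift ord0 i)].
have E c : satisfies switched_prod (dfwith z (i := lift ord0 j) c)
           <-> z ord0 = switched_prod (upd j x c).
  rewrite /satisfies dfwith_out 1?eq_sym ?neq_lift //.
  suff -> : [ffun i => dfwith z (i := lift ord0 j) c (lift ord0 i)]
            = upd j x c by [].
  apply/ffunP => i; rewrite !ffunE; case: eqVneq => [->|ij].
    by rewrite dfwith_in.
  by rewrite dfwith_out // (inj_eq lift_inj) eq_sym.
have [g gK Kg] := switched_bij j x.
exists (g (z ord0)); split=> [|c /E ->]; last exact: gK.
by apply/E; rewrite Kg.
Qed.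

Let spike i j l (c d t : S) : {ffun 'I_n -> S} :=
  [ffun k => if k == i then c else if k == j then d
             else if k == l then t else e].

Lemma loop_prod_spike i j l c d t : i < j -> l != i -> l != j ->
  loop_prod (enum 'I_n) (spike i j l c d t) =
    if l < i then op t (op c d)
    else if l < j then op c (op t d) else op c (op d t).
Proof.
move=> ij li lj.
have [ji jl il] : [/\ j != i, j != l & i != l].
  by rewrite ![_ == l]eq_sym li lj -val_eqE /= gtn_eqF.
have out (s : seq 'I_n) : s =i [:: i; j; l] ->
    forall k, k \notin s -> spike i j l c d t k = e.
  move=> sE k; rewrite sE !inE !negb_or ffunE.
  by case/and3P=> /negPf-> /negPf-> /negPf->.
have vals : (spike i j l c d t i = c) * (spike i j l c d t j = d)
          * (spike i j l c d t l = t).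
  by rewrite !ffunE !eqxx (negPf ji) (negPf li) (negPf lj).
case: ltngtP li => // [l_i _|i_l _|/val_inj-> /eqP //].
  rewrite (loop_prod3 l_i ij) ?vals //; apply: out => k.
  by rewrite !inE; do 3!case: eqP.
case: ltngtP lj => // [l_j _|j_l _|/val_inj-> /eqP //].
  rewrite (loop_prod3 i_l l_j) ?vals //; apply: out => k.
  by rewrite !inE; do 3!case: eqP.
by rewrite (loop_prod3 ij j_l) ?vals //; apply: out.
Qed.

Lemma switched_irreducible : irreducible switched_prod.
Proof.
case=> k [k_gt1 [lt_kn [s [h [g [qh _ fE]]]]]]; move: fE.
set idx := cast_ord _ => fE.
have nk_gt0 : 0 < n - k by rewrite subn_gt0.
(* Since 1 < k < n, [g] takes at least two arguments, here [i0] and [j0], and misses at least one,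
   here [l]. *)
pose i0 := s (idx (lshift (n - k) (Ordinal (ltnW k_gt1)))).
pose j0 := s (idx (lshift (n - k) (Ordinal k_gt1))).
pose l := s (idx (rshift k (Ordinal nk_gt0))).
have idx_inj : injective (s \o idx)
  by apply: inj_comp perm_inj (@cast_ord_inj _ _ _).
(* The two are named so that i < j, because the factors are multiplied in index order. *)
have [i [j [ij li lj [i' iE] [j' jE]]]] : exists i j, [/\ i < j, l != i, l != j,
    exists i' : 'I_k, i = s (idx (lshift (n - k) i')) &
    exists j' : 'I_k, j = s (idx (lshift (n - k) j'))].
  have l_i0 : l != i0 by rewrite (inj_eq idx_inj) eq_sym eq_lrshift.
  have l_j0 : l != j0 by rewrite (inj_eq idx_inj) eq_sym eq_lrshift.
  case: (ltngtP i0 j0) => [ij|ji|/val_inj/idx_inj/lshift_inj //].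
    by exists i0, j0; split=> //;
      [exists (Ordinal (ltnW k_gt1))|exists (Ordinal k_gt1)].
  by exists j0, i0; split=> //;
    [exists (Ordinal k_gt1)|exists (Ordinal (ltnW k_gt1))].
have sm_e : small e by rewrite /small /= eqxx.
have sm_a : small a = false.
  by rewrite /small /= (negPf (a_neq1 L)) (negPf (a_nequ L)).
have fE0 : switched_prod (spike i j l e e e) = u.
  rewrite /switched_prod loop_prod_spike // !(op1x L) !if_same.
  rewrite /swap eqxx ifT //.
  by apply/forallP => m; rewrite ffunE !if_same.
have big c d t m : small (spike i j l c d t m) = false ->
    switched_prod (spike i j l c d t)
      = loop_prod (enum 'I_n) (spike i j l c d t).
  move=> nsm; rewrite /switched_prod ifF //.
  by apply/negP => /forallP/(_ m); rewrite nsm.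
have at_i c d t : spike i j l c d t i = c by rewrite ffunE eqxx.
have at_l c d t : spike i j l c d t l = t.
  by rewrite ffunE eqxx (negPf li) (negPf lj).
have fE1 : switched_prod (spike i j l a b e) = e.
  rewrite (big _ _ _ i) ?at_i // loop_prod_spike //.
  by rewrite !(op1x L) (opx1 L) !(opab L) !if_same.
have fE2 : switched_prod (spike i j l e e a) = a.
  rewrite (big _ _ _ l) ?at_l // loop_prod_spike //.
  by rewrite !(op1x L) (opx1 L) !if_same.
(* For the three positions of [l] the product is a(ab), a(ab) or a(ba); each collapses to ae = a,
   although [op] need not be associative. *)
have fE3 : switched_prod (spike i j l a b a) = a.
  rewrite (big _ _ _ i) ?at_i // loop_prod_spike // (opab L) (opba L) (opx1 L).
  by rewrite !if_same.
(* As [g] takes [i] and [j] but not [l], the placeholder [e] put at [l] in [G], and those put at [i]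
   and [j] in [Y], are never read. *)
pose G c d := g [ffun m => spike i j l c d e (s (idx (lshift (n - k) m)))].
pose Y t := [ffun m => spike i j l e e t (s (idx (rshift k m)))].
have fG c d t :
    switched_prod (spike i j l c d t) = h (tuple_cons (G c d) (Y t)).
  rewrite fE; congr (h (tuple_cons (g _) _)); apply/ffunP => m; rewrite !ffunE.
    by rewrite (inj_eq idx_inj) eq_lrshift.
  by rewrite iE jE !(inj_eq idx_inj) !eq_rlshift.
(* Equal values for t = a give equal inner values by cancellation; for t = e these would force u =
   e. *)
have GE : G e e = G a b.
  by apply: (quasigroup_consI (t := Y a) qh); rewrite -!fG fE2 fE3.
by have /eqP[] := u_neq1 L; rewrite -[LHS]fE0 -[RHS]fE1 !fG GE.
Qed.

End Switching.

(** * Switchable loops of finite order *)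

Section FiniteOrders.
Import GRing.Theory.
Local Open Scope ring_scope.

Lemma zmod_switchable_loop (V : zmodType) (u a : V) :
  u != 0 -> u + u = 0 -> a != 0 -> a != u ->
  switchable_loop (S := V) +%R 0 u a (- a).
Proof.
move=> u0 uu a0 au; have bl (x : V) : bijective (+%R x).
  by exists (+%R (- x)); [apply: addKr|apply: addNKr].
have br (x : V) : bijective (+%R^~ x).
  by exists (fun z => z - x); [apply: addrK|apply: subrK].
by split=> //; [apply: add0r|apply: addr0|apply: subrr|apply: addNr].
Qed.

(* With [h = 1/2], the quasigroup [(x, y) |-> h * (x + y)] on [R] has the
   disjoint transversals [y = x] and [y = x + 2]; their values are displaced by
   two new elements, [inl false] (the neutral one) and [inl true]. *)
Definition prolong_add (R : comNzRingType) (h : R) (p q : bool + R) :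
    bool + R :=
  match p, q with
  | inl i, inl j => inl (i (+) j)
  | inl i, inr y => inr (if i then y - 1 else y)
  | inr x, inl j => inr (if j then x + 1 else x)
  | inr x, inr y =>
      if y == x then inl false
      else if y == x + 2 then inl true else inr (h * (x + y))
  end.

(** In row [inr x] the transversals displace the values x and x + 1, which reappear in the columns
    [inl false] and [inl true]; in column [inr y] they displace y and y - 1, which reappear in the
    rows [inl false] and [inl true]. So all translations are injective, hence bijective by
    finiteness. *)
Lemma prolong_switchable_loop (R : finComNzRingType) (h : R) : h + h = 1 ->
  switchable_loop (@prolong_add R h) (inl false) (inl true) (inr 0) (inr 0).
Proof.
move=> hh.
have hI : injective ( *%R h).
  move=> x y /(congr1 (fun z => z + z)); rewrite -!mulrDl hh !mul1r //.
have h2 : h * 2 = 1 by rewrite mulr_natr mulr2n.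
have hxx x : h * (x + x) = x by rewrite mulrDr -mulrDl hh mul1r.
have hxx2 x : h * (x + (x + 2)) = x + 1 by rewrite addrA mulrDr hxx h2.
have hyy2 y : h * (y - 2 + y) = y - 1.
  by rewrite addrAC mulrDr hxx mulrN h2.
have E2 (x y : R) : (y == x + 2) = (x == y - 2).
  by rewrite eq_sym -subr_eq opprK.
have neq1 (x : R) : (x + 1 == x) = false.
  by rewrite -subr_eq0 addrAC subrr add0r oner_eq0.
split=> //; try by case=> [[]|].
- move=> p; apply: injF_bij; case: p => [i|x] [j|y] [j'|y'] //=.
  + by case=> /addbI->.
  + by case: i => [[/addIr->]|[->]].
  + by case: j j' => [] [] // [/eqP]; rewrite ?[x == _]eq_sym neq1.
  (* By cancellation, an entry of row x equal to x + 1 or x would stand in column x + 2 or x, on a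
     transversal. *)
  + case: eqVneq => // yx; case: eqVneq => // yx2; case: j => -[] E.
      by have /hI/addrI y2 := etrans (hxx2 x) E; rewrite y2 eqxx in yx2.
    by have /hI/addrI y2 := etrans (hxx x) E; rewrite y2 eqxx in yx.
  + case: eqVneq => // yx; case: eqVneq => // yx2; case: j' => -[] E.
      by have /hI/addrI y2 := etrans (hxx2 x) (esym E); rewrite y2 eqxx in yx2.
    by have /hI/addrI y2 := etrans (hxx x) (esym E); rewrite y2 eqxx in yx.
  + case: (eqVneq y x) => ?; case: (eqVneq y' x) => ?;
      case: (eqVneq y (x + 2)) => ?; case: (eqVneq y' (x + 2)) => ? //;
      try by congruence.
    by case=> /hI /addrI ->.
- move=> p; apply: injF_bij; case: p => [i|y] [j|x] [j'|x'] //=.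
  + by case=> /addIb->.
  + by case: i => [[/addIr->]|[->]].
  + case: j j' => [] [] // [/eqP];
      by rewrite ?[y == _]eq_sym subr_eq eq_sym neq1.
  + rewrite E2 [y == _]eq_sym; case: eqVneq => // xy; case: eqVneq => // xy2.
    case: j => -[] E.
      by have /hI/addIr x2 := etrans (hyy2 y) E; rewrite x2 eqxx in xy2.
    by have /hI/addIr x2 := etrans (hxx y) E; rewrite x2 eqxx in xy.
  + rewrite E2 [y == _]eq_sym; case: eqVneq => // xy; case: eqVneq => // xy2.
    case: j' => -[] E.
      by have /hI/addIr x2 := etrans (hyy2 y) (esym E); rewrite x2 eqxx in xy2.
    by have /hI/addIr x2 := etrans (hxx y) (esym E); rewrite x2 eqxx in xy.
  + rewrite !E2 ![y == _]eq_sym.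
    case: (eqVneq x y) => ?; case: (eqVneq x' y) => ?;
      case: (eqVneq x (y - 2)) => ?; case: (eqVneq x' (y - 2)) => ? //;
      try by congruence.
    by case=> /hI /addIr ->.
- by rewrite /prolong_add eqxx.
- by rewrite /prolong_add eqxx.
Qed.

Lemma even_switchable_loop (m : nat) :
  exists (S : finType) (op : S -> S -> S) (e u a b : S),
    #|S| = (m.+2).*2 /\ switchable_loop op e u a b.
Proof.
pose V := ('I_2 * 'I_m.+2)%type.
exists V, +%R, 0, (1, 0), (0, 1), (- (0, 1)).
split; first by rewrite card_prod !card_ord mul2n.
apply: zmod_switchable_loop => //; rewrite -[_ + _]/(1 + 1, 0 + 0) addr0.
by congr pair; apply: val_inj.
Qed.

Lemma odd_switchable_loop (m : nat) :
  exists (S : finType) (op : S -> S -> S) (e u a b : S),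
    #|S| = (m.+2).*2.+1 /\ switchable_loop op e u a b.
Proof.
(* Since 2(m + 2) = (2m + 3) + 1, the residue m + 2 is one half modulo 2m + 3. *)
exists (bool + 'I_(m.*2.+3))%type, (prolong_add (m.+2)%:R).
eexists; eexists; eexists; eexists; split; last apply: prolong_switchable_loop.
  by rewrite card_sum card_bool card_ord.
rewrite -natrD addnn; apply: val_inj.
by rewrite Zp_nat /= doubleS -(addn1 m.*2.+3) modnDl.
Qed.

End FiniteOrders.

(** * Comparability of cardinals *)

Local Open Scope classical_set_scope.
Local Open Scope card_scope.

(** Zorn's lemma yields a maximal graph of a partial injection from [A] to [B]; it is defined on all
    of [A] or takes every value in [B]. *)
Lemma card_le_total (T U : Type) (A : set T) (B : set U) :
  (A #<= B) || (B #<= A).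
Proof.
pose P (G : set (T * U)) :=
  [/\ forall p, G p -> A p.1 /\ B p.2,
      forall x y y', G (x, y) -> G (x, y') -> y = y'
    & forall x x' y, G (x, y) -> G (x', y) -> x = x'].
have [F FP Ftot|G [[GAB Gfun Ginj] Gmax]] := @Zorn_bigcup _ P.
  have common p q : (\bigcup_(X in F) X) p -> (\bigcup_(X in F) X) q ->
      exists2 X, F X & X p /\ X q.
    case=> X FX Xp [Y FY Yq]; case: (Ftot X Y FX FY) => sub.
      by exists Y => //; split=> //; apply: sub.
    by exists X => //; split=> //; apply: sub.
  split=> [p [X /FP[XAB _ _] /XAB //]|x y y' p q|x x' y p q].
    by case: (common _ _ p q) => X /FP[_ Xf _] []; apply: Xf.
  by case: (common _ _ p q) => X /FP[_ _ Xi] []; apply: Xi.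
have [Gtot|/existsNP[x /not_implyP[Ax Nx]]] :=
  pselect (forall x, A x -> exists y, G (x, y)).
  apply/orP; left; have [f fP] : {f : A -> B & forall x, G (val x, val (f x))}.
    apply: (@boolp.choice A B (fun x y => G (val x, val y))) => x.
    have /Gtot[y Gxy] := set_mem (valP x).
    have [_ /= By] := GAB _ Gxy; by exists (SigSub (mem_set By)).
  apply/card_leP/injfunPex; exists f => // x y _ _ fxy.
  by apply: val_inj; apply: Ginj (fP x) _; rewrite fxy.
have [Gsurj|/existsNP[y /not_implyP[By Ny]]] :=
  pselect (forall y, B y -> exists x, G (x, y)).
  apply/orP; right; have [f fP] : {f : B -> A & forall y, G (val (f y), val y)}.
    apply: (@boolp.choice B A (fun y x => G (val x, val y))) => y.
    have /Gsurj[x' Gxy] := set_mem (valP y).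
    have [/= Ax' _] := GAB _ Gxy; by exists (SigSub (mem_set Ax')).
  apply/card_leP/injfunPex; exists f => // y y' _ _ fyy.
  by apply: val_inj; apply: Gfun (fP y) _; rewrite fyy.
(* Otherwise the unmatched [x] and [y] could be paired, enlarging [G]. *)
exfalso; apply: (Gmax (G `|` [set (x, y)])).
  split; first by left.
  by move=> /(_ (x, y)) sub; apply: Nx; exists y; apply: sub; right.
split=> [p [/GAB //|->//]|x1 y1 y2|x1 x2 y1].
- move=> [g1|[ex ey]] [g2|[ex' ey']]; last by rewrite ey ey'.
  + exact: Gfun g1 g2.
  + by case: Nx; exists y1; rewrite -ex'.
  + by case: Nx; exists y2; rewrite -ex.
- move=> [g1|[ex ey]] [g2|[ex' ey']]; last by rewrite ex ex'.
  + exact: Ginj g1 g2.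
  + by case: Ny; exists x1; rewrite -ey'.
  + by case: Ny; exists x2; rewrite -ey.
Qed.

(** * Steiner loops of infinite order *)

Section Infinite.

Variables (K : choiceType) (e u a : K).

(* Steiner loops carried by subsets of [K]. The [dbl] maps witness that [dom]
   has the cardinality of two copies of itself, which makes a maximal structure
   equinumerous to [K]. *)
Record steiner := Steiner {
  dom : set K;
  add : K -> K -> K;
  dbl : bool -> K -> K;
  dom_e : dom e;
  dom_u : dom u;
  dom_a : dom a;
  dom_add : forall x y, dom x -> dom y -> dom (add x y);
  dom_dbl : forall i x, dom x -> dom (dbl i x);
  addC : forall x y, dom x -> dom y -> add x y = add y x;
  addK : forall x y, dom x -> dom y -> add x (add x y) = y;
  add_e : forall x, dom x -> add e x = x;
  dbl_inj : forall i j x y, dom x -> dom y -> dbl i x = dbl j y ->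
    (i, x) = (j, y) }.

(** The operations are total on [K] but meaningful only on [dom]. Structures differing only
    elsewhere lie below each other, so this is merely a preorder. *)
Definition substeiner (s t : steiner) : Prop :=
  [/\ dom s `<=` dom t,
      forall x y, dom s x -> dom s y -> add t x y = add s x y
    & forall i x, dom s x -> dbl t i x = dbl s i x].

(** The union of the chain serves: any two of its points lie in a common member, and the members
    agree where they overlap. *)
Lemma steiner_chain_ub (F : set steiner) (s0 : steiner) :
  F s0 -> total_on F substeiner ->
  exists t, forall s, F s -> substeiner s t.
Proof.
move=> Fs0 Ftot.
pose D : set K := \bigcup_(s in F) dom s.
have pair x y : D x -> D y -> exists s, [/\ F s, dom s x & dom s y].
  case=> s Fs sx [t Ft ty]; case: (Ftot s t Fs Ft) => -[st _ _].
    by exists t; split=> //; apply: st.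
  by exists s; split=> //; apply: st.
have [ad adP] : {ad : K * K -> K & forall p s, F s -> dom s p.1 -> dom s p.2 ->
    ad p = add s p.1 p.2}.
  apply: (@boolp.choice (K * K)%type K (fun p z => forall s, F s -> dom s p.1 ->
    dom s p.2 -> z = add s p.1 p.2)) => -[x y] /=.
  have [[s [Fs sx sy]]|no] := pselect (exists s, [/\ F s, dom s x & dom s y]).
    exists (add s x y) => t Ft tx ty.
    by case: (Ftot s t Fs Ft) => -[_ E _]; rewrite E.
  (* No member contains both points, so the value is arbitrary. *)
  by exists x => s Fs sx sy; case: no; exists s.
have [db dbP] : {db : bool * K -> K & forall p s, F s -> dom s p.2 ->
    db p = dbl s p.1 p.2}.
  apply: (@boolp.choice (bool * K)%type K (fun p z => forall s, F s ->
    dom s p.2 -> z = dbl s p.1 p.2)) => -[i x] /=.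
  have [[s [Fs sx]]|no] := pselect (exists s, F s /\ dom s x).
    exists (dbl s i x) => t Ft tx.
    by case: (Ftot s t Fs Ft) => -[_ _ E]; rewrite E.
  by exists x => s Fs sx; case: no; exists s.
unshelve eexists (@Steiner D (fun x y => ad (x, y)) (fun i x => db (i, x))
  _ _ _ _ _ _ _ _ _).
- by exists s0 => //; apply: dom_e.
- by exists s0 => //; apply: dom_u.
- by exists s0 => //; apply: dom_a.
- move=> x y Dx Dy; have [s [Fs sx sy]] := pair x y Dx Dy.
  by exists s => //; rewrite (adP _ s) //; apply: dom_add.
- by move=> i x [s Fs sx]; exists s => //; rewrite (dbP _ s) //; apply: dom_dbl.
- move=> x y Dx Dy; have [s [Fs sx sy]] := pair x y Dx Dy.
  by rewrite !(adP _ s) //= addC.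
- move=> x y Dx Dy; have [s [Fs sx sy]] := pair x y Dx Dy.
  by rewrite (adP (x, y) s) // (adP _ s) //= ?addK //; apply: dom_add.
- by move=> x [s Fs sx]; rewrite (adP _ s) //= ?add_e //; apply: dom_e.
- move=> i j x y Dx Dy; have [s [Fs sx sy]] := pair x y Dx Dy.
  by rewrite !(dbP _ s) //=; apply: dbl_inj.
move=> s Fs; split=> /= [x sx|x y sx sy|i x sx]; first by exists s.
- exact: adP.
- exact: dbP.
Qed.

(** The extension is the direct product of [s] with Z_2, its second copy being placed outside
    [dom s] by [phi]; the doubling maps act on each copy separately. *)
Lemma steiner_extend (s : steiner) (phi : K -> K) :
  (forall x, dom s x -> ~ dom s (phi x)) ->
  (forall x y, dom s x -> dom s y -> phi x = phi y -> x = y) ->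
  exists2 t, substeiner s t & dom t (phi e).
Proof.
move=> phiN phi_inj.
pose emb (i : bool) x := if i then phi x else x.
pose D : set K := [set y | exists i x, dom s x /\ y = emb i x].
(* [base] decodes a point into its copy and its original in [dom s]. *)
have [base baseP] : {f : K -> bool * K &
    forall i x, dom s x -> f (emb i x) = (i, x)}.
  have [f fP] : {f : K -> bool * K & forall y i x, dom s x -> y = emb i x ->
      f y = (i, x)}; last by exists f => i x sx; apply: fP.
  apply: (@boolp.choice K (bool * K)%type (fun y p => forall i x, dom s x ->
    y = emb i x -> p = (i, x))) => y.
  have [[i [x [sx ->]]]|no] := pselect (D y).
    exists (i, x) => j x' sx'; rewrite /emb; case: i; case: j => E.
    + by rewrite (phi_inj x x').
    + by have := phiN x sx; rewrite E.
    + by have := phiN x' sx'; rewrite -E.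
    + by rewrite E.
  by exists (true, y) => i x sx yE; case: no; exists i, x.
pose ad p q := emb ((base p).1 (+) (base q).1) (add s (base p).2 (base q).2).
pose db i p := emb (base p).1 (dbl s i (base p).2).
have adE i j x y : dom s x -> dom s y ->
    ad (emb i x) (emb j y) = emb (i (+) j) (add s x y).
  by move=> sx sy; rewrite /ad !baseP.
have dbE i j x : dom s x -> db i (emb j x) = emb j (dbl s i x).
  by move=> sx; rewrite /db !baseP.
have DI i x : dom s x -> D (emb i x) by exists i, x.
have De := DI false e (dom_e s).
have Du := DI false u (dom_u s).
have Da := DI false a (dom_a s).
unshelve eexists (@Steiner D ad db De Du Da _ _ _ _ _ _).
- move=> _ _ [i [x [sx ->]]] [j [y [sy ->]]].
  by rewrite adE //; apply/DI/dom_add.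
- by move=> i _ [j [x [sx ->]]]; rewrite dbE //; apply/DI/dom_dbl.
- move=> _ _ [i [x [sx ->]]] [j [y [sy ->]]].
  by rewrite !adE // addbC addC.
- move=> _ _ [i [x [sx ->]]] [j [y [sy ->]]].
  by rewrite !adE ?addbA ?addbb ?addK //; apply: dom_add.
- move=> _ [i [x [sx ->]]].
  by rewrite -[e]/(emb false e) adE ?add_e //; apply: dom_e.
- move=> i j _ _ [i' [x [sx ->]]] [j' [y [sy ->]]].
  rewrite !dbE // => /(congr1 base); rewrite !baseP; try exact: dom_dbl.
  by case=> -> E; have [-> ->] := dbl_inj sx sy E.
- split=> [x sx|x y sx sy|i x sx] /=; first exact: (DI false).
  + by rewrite -[x in LHS]/(emb false x) -[y in LHS]/(emb false y) adE.
  + by rewrite -[x in LHS]/(emb false x) dbE.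
- exact: (DI true e (dom_e s)).
Qed.

(** A countable starting point for Zorn's lemma: bitwise exclusive or on the naturals, doubled by m
    to 2m and 2m + 1, transported along [iota]. *)
Lemma nat_steiner (iota : nat -> K) : injective iota ->
  iota 0 = e -> iota 1 = u -> iota 2 = a -> steiner.
Proof.
move=> iI i0 i1 i2.
have [idx idxK] : {idx : K -> nat & forall m, idx (iota m) = m}.
  have [f fP] : {f : K -> nat & forall y m, y = iota m -> f y = m}.
    apply: (@boolp.choice K nat
      (fun y k => forall m, y = iota m -> k = m)) => y.
    have [[m ->]|no] := pselect (exists m, y = iota m).
      by exists m => m' /iI.
    by exists 0 => m yE; case: no; exists m.
  by exists f => m; apply: fP.
pose D := range iota.
pose ad x y := iota (Nat.lxor (idx x) (idx y)).
pose db (i : bool) x := iota (i + (idx x).*2).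
have DI m : D (iota m) by exists m.
apply: (@Steiner D ad db); rewrite -?i0 -?i1 -?i2 //.
- by move=> x y _ _; apply: DI.
- by move=> i x _; apply: DI.
- by move=> x y _ _; rewrite /ad Nat.lxor_comm.
- move=> x _ _ [m _ <-]; rewrite /ad !idxK.
  by rewrite -Nat.lxor_assoc Nat.lxor_nilpotent Nat.lxor_0_l.
- by move=> _ [m _ <-]; rewrite /ad !idxK Nat.lxor_0_l.
- move=> i j _ _ [m _ <-] [k _ <-]; rewrite /db !idxK => /iI E.
  (* Parity tells the two copies apart. *)
  have := congr1 odd E; rewrite !oddD !odd_double !addbF !oddb => ij.
  by move: E; rewrite ij => /addnI/double_inj ->.
Qed.

(** Let [s] be maximal. If the complement of [dom s] injects into [dom s], then [K] injects into two
    copies of [dom s], which [dbl] folds into one. Otherwise [dom s] injects into its complement,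
    and [steiner_extend] contradicts maximality. *)
Lemma full_steiner : steiner -> exists s, [set: K] #<= dom s.
Proof.
move=> s0.
have [] := @ZL_preorder steiner s0 (fun s t => `[< substeiner s t >]).
- by move=> s; apply/asboolP; split.
- move=> r s t /asboolP[rs radd rdbl] /asboolP[st sadd sdbl]; apply/asboolP.
  split=> [x rx|x y rx ry|i x rx]; first exact/st/rs.
    by rewrite sadd ?radd //; apply: rs.
  by rewrite sdbl ?rdbl //; apply: rs.
- move=> F Ftot; have [[s Fs]|no] := pselect (F !=set0); last first.
    by exists s0 => s Fs; case: no; exists s.
  have [|t tP] := steiner_chain_ub Fs.
    by move=> r t Fr Ft; case: (Ftot r t Fr Ft) => /asboolP; [left|right].
  by exists t => r Fr; apply/asboolP/tP.
move=> s smax; exists s; pose P := isPointed.Build K e.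
pose K' : pointedType := HB.pack K P.
have /orP[le|le] := card_le_total (~` (dom s : set K')) (dom s : set K').
  have /injfunPex[psi psiD psiI] := elimT pcard_leP le.
  apply: (introT (@pcard_leP K K' _ _)); apply/injfunPex.
  exists (fun x =>
    if pselect (dom s x) then dbl s false x else dbl s true (psi x)).
    by move=> x _; case: pselect => [sx|nx]; apply: dom_dbl => //; apply: psiD.
  move=> x y _ _; case: pselect => [sx|nx]; case: pselect => [sy|ny] E.
  - by have [] := dbl_inj sx sy E.
  - by have [] := dbl_inj sx (psiD y ny) E.
  - by have [] := dbl_inj (psiD x nx) sy E.
  - have [pxy] := dbl_inj (psiD x nx) (psiD y ny) E.
    by apply: psiI pxy; rewrite inE.
have /injfunPex[phi phiD phiI] := elimT pcard_leP le.
have [|t st te] := @steiner_extend s phi phiD.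
  by move=> x y sx sy; apply: phiI; rewrite inE.
(* Maximality in a preorder puts [t] back below [s], so [phi e] would lie in [dom s]. *)
have /asboolP[ts _ _] := smax t (asboolT st).
by case: (phiD e (dom_e s)); apply: ts.
Qed.

(** Translations are involutions by x(xy) = y and commutativity, and xx = x(xe) = e; so every
    element is its own inverse, and b = a. *)
Lemma steiner_loop (s : steiner) : e != u -> a != e -> a != u ->
  exists (op : dom s -> dom s -> dom s) (e' u' a' : dom s),
    switchable_loop op e' u' a' a'.
Proof.
move=> eu ae au.
have memS (x : dom s) : dom s (val x) by apply: set_mem (valP x).
pose op (x y : dom s) : dom s := SigSub (mem_set (dom_add (memS x) (memS y))).
have opC x y : op x y = op y x by apply: val_inj; apply: addC.
have opK x : involutive (op x) by move=> y; apply: val_inj; apply: addK.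
pose e' : dom s := SigSub (mem_set (dom_e s)).
pose u' : dom s := SigSub (mem_set (dom_u s)).
pose a' : dom s := SigSub (mem_set (dom_a s)).
have op1x x : op e' x = x by apply: val_inj; apply: add_e.
have opxx x : op x x = e' by rewrite -{2}(op1x x) (opC e') opK.
exists op, e', u', a'; split=> //.
- by move=> x; apply: inv_bij.
- by move=> y; apply: (eq_bij (inv_bij (opK y))) => x.
- by move=> x; rewrite opC.
- by rewrite -val_eqE /= eq_sym.
Qed.

End Infinite.

(** * Existence in every order from 4 on *)

Lemma infinite_switchable_loop (K : Type) : infinite_set [set: K] ->
  exists (S : eqType) (op : S -> S -> S) (e u a : S),
    [set: S] #= [set: K] /\ switchable_loop op e u a a.
Proof.
elim/Ppointed: K => K; first by rewrite empty_eq0; case.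
move=> /infiniteP/pcard_injP[iota iotaI].
have {}iotaI : injective iota by move=> i j; apply: iotaI; rewrite inE.
(* The points e, u and a are the images of 0, 1 and 2 under [iota]. *)
have [s Ks] := full_steiner (nat_steiner iotaI erefl erefl erefl).
have [||| op [e [u [a L]]]] := @steiner_loop _ _ _ _ s;
  rewrite ?(inj_eq iotaI) //.
exists (dom s : eqType), op, e, u, a; split=> //.
(* Cantor-Bernstein: [dom s] is a subset of [K], and [K] injects into it. *)
by rewrite (card_eql (card_setT _)) card_eq_le Ks card_leT.
Qed.

Lemma exists_switchable_loop (K : Type) : [set: 'I_4] #<= [set: K] ->
  exists (S : eqType) (op : S -> S -> S) (e u a b : S),
    [set: S] #= [set: K] /\ switchable_loop op e u a b.
Proof.
move=> le4K.
have [[k Kk]|Kinf] := boolp.pselect (finite_set [set: K]); last first.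
  have [S [op [e [u [a SL]]]]] := infinite_switchable_loop Kinf.
  by exists S, op, e, u, a, a.
have ge4 : 4 <= k.
  by rewrite -card_le_II -(card_le_eqr Kk) (card_le_eql card_II).
suff [S [op [e [u [a [b [Sk L]]]]]]] : exists (S : finType) (op : S -> S -> S)
    (e u a b : S), #|S| = k /\ switchable_loop op e u a b.
  exists S, op, e, u, a, b; split=> //.
  rewrite (card_eqr Kk) (card_eqr card_II) -Sk.
  have [f] : $|{bij [set: S] >-> [set: 'I_#|S|]}|.
    by apply/bijPex; exists enum_rank; split.
  exact: pcard_eq f.
(* From k >= 4 the half of k is at least 2, so k is 2(m + 2) or 2(m + 2) + 1. *)
have [m km] : exists m, k./2 = m.+2.
  by exists k./2.-2; case: k ge4 {Kk} => [|[|[|[|k]]]].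
have -> : k = odd k + m.+2.*2 by rewrite -km odd_double_half.
case: (odd k).
  exact: odd_switchable_loop.
exact: even_switchable_loop.
Qed.

(* The order k >= 4, finite or infinite, is the cardinality of a type K. *)
Theorem theorem2 (n : nat) (K : Type) (le3n : (3 <= n)%N)
    (le4K : [set: 'I_4] #<= [set: K]) :
  exists (Sigma : Type) (f : operation n Sigma),
    [/\ [set: Sigma] #= [set: K], quasigroup f & irreducible f].
Proof.
have [S [op [e [u [a [b [SK L]]]]]]] := exists_switchable_loop le4K.
exists S, (@switched_prod n S op e u); split=> //.
  exact: switched_quasigroup L.
exact: switched_irreducible L.
Qed.
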